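(* Let $p\in\mathbb R[x]$ be a polynomial of degree $d\ge 1$ with $p(0)=0$, and let $(n_i)_{i=1}^\infty$ be a sequence of positive integers. Then for every $\varepsilon>0$ there exists a finite non-empty set $\alpha\subset\mathbb N$ with gaps bounded by $d$ (i.e. $\alpha\in\mathcal S_d$) such that $\big\|p\big(\sum_{i\in\alpha}n_i\big)\big\|_{\mathbb R/\mathbb Z}\le\varepsilon$.
   Context: $\mathbb N=\{1,2,\dots\}$. $\|x\|_{\mathbb R/\mathbb Z}$ denotes the distance from $x\in\mathbb R$ to the nearest integer. For a finite set $\alpha=\{i_1<i_2<\dots<i_r\}$ its gaps are $i_2-i_1,\dots,i_r-i_{r-1}$. For $k\ge0$, $\mathcal S_k$ denotes the family of finite non-empty $\alpha\subset\mathbb N$ such that for every $i\in\alpha$, either $i=\max\alpha$ or there is $j\in\alpha$ with $i<j\le i+k$. *)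

(* Defs.v *)
From Stdlib Require Import Reals Lra Lia List.
Open Scope R_scope.

Definition poly_eval (a : nat -> R) (d : nat) (x : R) : R :=
  sum_f_R0 (fun k => a k * x ^ k) d.

(* ||x||_{R/Z}: distance from x to the nearest integer
   (the nearest integer is either floor x or floor x + 1). *)
Definition dist_Z (x : R) : R :=
  Rmin (frac_part x) (1 - frac_part x).

Definition finset_pos (alpha : list nat) : Prop :=
  NoDup alpha /\ (forall i, In i alpha -> (1 <= i)%nat).

Definition in_S (k : nat) (alpha : list nat) : Prop :=
  alpha <> nil /\
  forall i, In i alpha ->
    (forall j, In j alpha -> (j <= i)%nat) \/
    (exists j, In j alpha /\ (i < j)%nat /\ (j <= i + k)%nat).

Definition sum_over (n : nat -> nat) (alpha : list nat) : nat :=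
  fold_right (fun i acc => (n i + acc)%nat) 0%nat alpha.

(* Main.v *)
Require Import Defs.
From Stdlib Require Import Reals List.
From Stdlib Require Import Lra Lia.
From HB Require structures.
From mathcomp Require all_boot ssralg ssrint zmodp boolp filter functions zify.
Open Scope R_scope.

(* Cut the positive integers into the [d] residue classes mod [d]. A word S_1, ..., S_m
   of non-empty sets of classes, consecutive ones meeting, together with break points
   t_0 < ... < t_m at distances at least [d], gives a set with gaps at most [d]: between
   t_(j-1) and t_j take the indices with class in S_j. With N_S(t) the sum of the n_i
   over i < t with class in S, the sum over this set is the sum over j of
   N_(S_j)(t_j) - N_(S_(j+1))(t_j), where S_0 and S_(m+1) are empty. Letting t_m, ..., t_0
   tend to infinity along an ultrafilter, one after the other, turns a word into a product of
   operators A(S_j, S_(j+1)), where A(S, S') q (x) = lim_t q (x + N_S(t) - N_S'(t)), acting on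
   polynomial maps from Z to R/Z of degree at most [d]. These operators are additive and
   unipotent, and it suffices to bring the value at 0 of a product applied to [p] close
   to p(0) = 0.

   For unipotent [h], the values of [h ^ k q] are polynomial in [k], so recurrence of polynomial
   sequences allows the use of inverses: everything in the group generated by the loops at
   the full set F of classes is approximated by loops. With A_b = A({b}, 0) and a fixed
   class [a], the operator g = A({a}, 0) A(0, {a}) lowers the degree by 2. For every set s of
   other classes except the set of all of them, the conjugate of [g] by the product of
   the A_b, b in s, is in that group: remove the classes in [s] from F, and then [a], which
   leaves a non-empty set. An iterated commutator of [g] with the d - 1 operators A_b
   lowers the degree by d + 1, so it is trivial, and hence the remaining conjugate is in the group
   as well. This conjugate is what passing through the empty set would give, and its inverse
   cancels the two passages between {a} and the empty set at the ends of a word. *)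

Module BoundedGaps.

Import HB.structures.
Import all_boot ssralg ssrint zmodp boolp filter functions zify.
Set Implicit Arguments.
Unset Strict Implicit.
Unset Printing Implicit Defensive.
Import GRing.Theory.
Local Open Scope group_scope.
Local Open Scope ring_scope.
Local Notation "x <=R y" := (Rle x y) (at level 70).
Local Notation "x <R y" := (Rlt x y) (at level 70).

(** * The circle [R / Z] *)

(** Elements are the canonical representatives in [0, 1), so Leibniz equality is equality in R/Z. *)
Record circle := Circle {lift : R; liftP : frac_part lift = lift}.

Lemma lift_inj : injective lift.
Proof.
move=> [x hx] [y hy] /= xy; case: _ / xy hy => hy.
by congr Circle; apply: Prop_irrelevance.
Qed.

Lemma frac_part_shift (x : R) (z : Z) : frac_part (Rplus x (IZR z)) = frac_part x.
Proof.
have [h1 h2] := base_Int_part x.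
rewrite /frac_part -(@Int_part_spec (Rplus x (IZR z)) (Z.add (Int_part x) z)); first by rewrite plus_IZR; ring.
by rewrite plus_IZR; lra.
Qed.

Lemma frac_partK (x : R) : frac_part (frac_part x) = frac_part x.
Proof.
have {2}-> : x = Rplus (frac_part x) (IZR (Int_part x)) by rewrite /frac_part; ring.
by rewrite frac_part_shift.
Qed.

Definition proj (x : R) : circle := Circle (frac_partK x).

Lemma proj_lift c : proj (lift c) = c.
Proof. by apply: lift_inj; exact: liftP. Qed.

Lemma proj_shift (x y : R) (z : Z) : x = Rplus y (IZR z) -> proj x = proj y.
Proof. by move=> ->; apply: lift_inj; rewrite /= frac_part_shift. Qed.

Lemma lift_proj (x : R) : exists z : Z, lift (proj x) = Rplus x (IZR z).
Proof. by exists (Z.opp (Int_part x)); rewrite opp_IZR. Qed.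

HB.instance Definition _ := gen_eqMixin circle.
HB.instance Definition _ := gen_choiceMixin circle.

Definition cadd (a b : circle) := proj (Rplus (lift a) (lift b)).
Definition copp (a : circle) := proj (Ropp (lift a)).
Definition czero := proj R0.

Lemma cadd_proj x y : cadd (proj x) (proj y) = proj (Rplus x y).
Proof.
rewrite /cadd; have [z ->] := lift_proj x; have [z' ->] := lift_proj y.
by apply: (@proj_shift _ _ (Z.add z z')); rewrite plus_IZR; ring.
Qed.

Lemma copp_proj x : copp (proj x) = proj (Ropp x).
Proof.
rewrite /copp; have [z ->] := lift_proj x.
by apply: (@proj_shift _ _ (Z.opp z)); rewrite opp_IZR; ring.
Qed.

Lemma caddA : associative cadd.
Proof.
move=> a b c; rewrite -(proj_lift a) -(proj_lift b) -(proj_lift c) !cadd_proj.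
by congr proj; ring.
Qed.

Lemma caddC : commutative cadd.
Proof. by move=> a b; rewrite /cadd; congr proj; ring. Qed.

Lemma cadd0 : left_id czero cadd.
Proof.
by move=> a; rewrite -(proj_lift a) cadd_proj; congr proj; ring.
Qed.

Lemma caddN : left_inverse czero copp cadd.
Proof.
by move=> a; rewrite -(proj_lift a) copp_proj cadd_proj; congr proj; ring.
Qed.

HB.instance Definition _ := GRing.isZmodule.Build circle caddA caddC cadd0 caddN.

Lemma projD x y : proj (Rplus x y) = proj x + proj y.
Proof. by rewrite -cadd_proj. Qed.

Lemma projB x y : proj (Rminus x y) = proj x - proj y.
Proof. by rewrite /Rminus projD; congr (_ + _); rewrite -copp_proj. Qed.

Definition nrm (c : circle) : R := dist_Z (lift c).

Lemma nrm_proj x : nrm (proj x) = dist_Z x.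
Proof. by rewrite /nrm /dist_Z /= frac_partK. Qed.

Lemma dist_Z_le x z : dist_Z x <=R Rabs (Rminus x (IZR z)).
Proof.
have [h1 h2] := base_fp x; rewrite /dist_Z.
have e : x = Rplus (frac_part x) (IZR (Int_part x)) by rewrite /frac_part; ring.
have [h|h] := Z.le_gt_cases z (Int_part x).
  apply: (Rle_trans _ (frac_part x)); first exact: Rmin_l.
  by apply: Rle_trans (Rle_abs _); move/IZR_le: h; lra.
apply: (Rle_trans _ (Rminus 1 (frac_part x))); first exact: Rmin_r.
have /IZR_le : Z.le (Z.add (Int_part x) 1) z by lia.
rewrite plus_IZR -Rabs_Ropp => h'; apply: Rle_trans (Rle_abs _); lra.
Qed.

Lemma dist_Z_ex x : exists z, dist_Z x = Rabs (Rminus x (IZR z)).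
Proof.
have [h1 h2] := base_fp x; rewrite /dist_Z.
have e : x = Rplus (frac_part x) (IZR (Int_part x)) by rewrite /frac_part; ring.
rewrite /Rmin; case: Rle_dec => h.
  by exists (Int_part x); rewrite Rabs_right; lra.
by exists (Z.add (Int_part x) 1); rewrite plus_IZR Rabs_left; lra.
Qed.

Lemma nrm_ge0 c : R0 <=R nrm c.
Proof. by rewrite /nrm; have [z ->] := dist_Z_ex (lift c); exact: Rabs_pos. Qed.

Lemma nrm0 : nrm 0 = R0.
Proof.
apply: Rle_antisym; last exact: nrm_ge0.
rewrite -[nrm _]/(nrm (proj R0)) nrm_proj; apply: (Rle_trans _ _ _ (dist_Z_le _ Z0)).
by rewrite Rminus_0_r Rabs_R0; lra.
Qed.

Lemma nrmN c : nrm (- c) = nrm c.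
Proof.
suff H c' : nrm (- c') <=R nrm c'.
  by apply: Rle_antisym => //; rewrite -{1}(opprK c); exact: H.
rewrite -(proj_lift c') -[- _]/(copp _) copp_proj !nrm_proj.
have [z ->] := dist_Z_ex (lift c'); rewrite -Rabs_Ropp.
by apply: (Rle_trans _ _ _ (dist_Z_le _ (Z.opp z))); rewrite opp_IZR; right; congr Rabs; ring.
Qed.

Lemma nrmD a b : nrm (a + b) <=R Rplus (nrm a) (nrm b).
Proof.
rewrite -(proj_lift a) -(proj_lift b) -projD !nrm_proj.
have [z ->] := dist_Z_ex (lift a); have [z' ->] := dist_Z_ex (lift b).
apply: Rle_trans (Rabs_triang _ _); apply: (Rle_trans _ _ _ (dist_Z_le _ (Z.add z z'))).
by rewrite plus_IZR; right; congr Rabs; ring.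
Qed.

Lemma nrmB a b : nrm (a - b) <=R Rplus (nrm a) (nrm b).
Proof. by rewrite -(nrmN b); exact: nrmD. Qed.

Lemma nrm_trans a b c x y :
  nrm (a - b) <R x -> nrm (b - c) <R y -> nrm (a - c) <R Rplus x y.
Proof.
move=> h1 h2; have h := nrmD (a - b) (b - c); rewrite subrKA in h.
exact: (Rle_lt_trans _ _ _ h (Rplus_lt_compat _ _ _ _ h1 h2)).
Qed.

Lemma nrm_eq0 c : nrm c = R0 -> c = 0.
Proof.
rewrite -(proj_lift c) nrm_proj; have [z ->] := dist_Z_ex (lift c) => h.
apply: (@proj_shift _ _ z); have := Rabs_no_R0 _; case: (Req_dec (Rminus (lift c) (IZR z)) 0) => [|h1 /(_ _ h1)//].
by rewrite Rplus_0_l; lra.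
Qed.

(** [large_unbounded] encodes both properness and non-principality. *)
Record nat_ultrafilter := NatUltrafilter {
  large :> (nat -> Prop) -> Prop;
  largeI A B : large A -> large B -> large (fun t => A t /\ B t);
  largeS A B : large A -> (forall t, A t -> B t) -> large B;
  largeC A : large A \/ large (fun t => ~ A t);
  large_unbounded A : large A -> forall K, exists t, (K <= t)%N /\ A t }.

Lemma nat_ultrafilter_ex : inhabited nat_ultrafilter.
Proof.
have [G [GU hG]] := ultraFilterLemma eventually_filter.
have GF := @ultra_proper _ _ GU.
have GI A B : G A -> G B -> G (fun t => A t /\ B t) by apply: filterI.
apply: inhabits; apply: (@NatUltrafilter G) => //.
- by move=> A B GA AB; apply: filterS GA.
- by move=> A; apply: in_ultra_setVsetC.
- move=> A GA K.
  have GK : G (fun t => (K <= t)%N) by apply: hG; exists K.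
  by have [t []] := filter_ex (GI _ _ GK GA); exists t.
Qed.

(** * Limits along an ultrafilter *)

Section Limits.
Variable U : nat_ultrafilter.
Implicit Types (x : nat -> circle) (c : circle).

Lemma largeT : U (fun=> True).
Proof. by case: (largeC U (fun=> True)) => // /largeS; apply. Qed.

Lemma large_ex A : U A -> exists t, A t.
Proof. by move=> /large_unbounded/(_ 0%N)[t []]; exists t. Qed.

Lemma large_forall (I : finType) (A : I -> nat -> Prop) :
  (forall i, U (A i)) -> U (fun t => forall i, A i t).
Proof.
move=> UA; have : U (fun t => forall i, i \in enum I -> A i t).
  elim: (enum I) => [|i s IHs]; first exact: largeS largeT _.
  apply: largeS (largeI (UA i) IHs) _ => t [Ait IHt] j.
  by rewrite inE => /predU1P [->|/IHt].
by move/largeS; apply=> t At i; apply: At; rewrite mem_enum.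
Qed.

(** The limit is the projection of the supremum of all y that lie below the representative of [x t]
    for [U]-many t. *)
Lemma lim_ex (x : nat -> circle) :
  exists c, forall e, R0 <R e -> U (fun t => nrm (x t - c) <R e).
Proof.
pose r t := lift (x t).
have r01 t : R0 <=R r t /\ r t <R R1.
  by have [? ?] := base_fp (r t); move: (liftP (x t)); rewrite -/(r t) => <-; split=> //; apply: Rge_le.
have bE : bound (fun y => U (fun t => y <=R r t)).
  by exists R1 => y /large_ex [t]; have [_ ?] := r01 t; lra.
have exE : exists y, U (fun t => y <=R r t).
  by exists R0; apply: largeS largeT _ => t _; case: (r01 t).
have [s [ub lub]] := completeness _ bE exE.
exists (proj s) => e e0.
have [y Uy ys] : exists2 y, U (fun t => y <=R r t) & Rminus s e <R y.
  apply: contrapT => H; suff : s <=R Rminus s e by lra.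
  by apply: lub => y Uy; apply: Rnot_lt_le => ys; apply: H; exists y.
have Us : U (fun t => ~ Rplus s e <=R r t).
  by case: (largeC U (fun t => Rplus s e <=R r t)) => // /ub; lra.
apply: largeS (largeI Uy Us) _ => t [h1 h2].
rewrite -(proj_lift (x t)) -projB nrm_proj.
apply: (Rle_lt_trans _ _ _ (dist_Z_le _ Z0)); rewrite Rminus_0_r -/(r t).
by apply: Rabs_def1; lra.
Qed.

Definition lim x := projT1 (cid (lim_ex x)).

Lemma lim_near x e : R0 <R e -> U (fun t => nrm (x t - lim x) <R e).
Proof. exact: (projT2 (cid (lim_ex x))). Qed.

Lemma lim_unique x c :
  (forall e, R0 <R e -> U (fun t => nrm (x t - c) <R e)) -> lim x = c.
Proof.
move=> xc; apply/eqP; rewrite -subr_eq0; apply/eqP/nrm_eq0/Rle_antisym; last exact: nrm_ge0.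
apply: Rnot_lt_le => h; set e := nrm _ in h.
have [t [h1 h2]] : exists t, nrm (x t - c) <R Rdiv e (IZR 2) /\ nrm (x t - lim x) <R Rdiv e (IZR 2).
  by apply: large_ex; apply: largeI; [apply: xc|apply: lim_near]; lra.
have : e <=R Rplus (nrm (x t - c)) (nrm (x t - lim x)); last by lra.
rewrite /e.
have <- : (x t - c) - (x t - lim x) = lim x - c by rewrite opprB addrC subrKA.
exact: nrmB.
Qed.

Lemma lim_cst c : lim (fun=> c) = c.
Proof. by apply: lim_unique => e e0; apply: largeS largeT _ => t _; rewrite subrr nrm0. Qed.

Lemma limB x (y : nat -> circle) : lim (fun t => x t - y t) = lim x - lim y.
Proof.
apply: lim_unique => e e0; have e2 : R0 <R Rdiv e (IZR 2) by lra.
apply: largeS (largeI (lim_near x e2) (lim_near y e2)) _ => t [h1 h2].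
have -> : x t - y t - (lim x - lim y) = (x t - lim x) - (y t - lim y).
  by rewrite !opprB addrACA [RHS]addrACA [- y t + _]addrC.
by apply: (Rle_lt_trans _ _ _ (nrmB _ _)); lra.
Qed.

Lemma nrm_lim_lt x e : nrm (lim x) <R e -> U (fun t => nrm (x t) <R e).
Proof.
move=> h; have e0 : R0 <R Rminus e (nrm (lim x)) by lra.
apply: largeS (lim_near x e0) _ => t ht.
by have := nrmD (x t - lim x) (lim x); rewrite subrK; lra.
Qed.

End Limits.

(** * Polynomial maps into the circle and their recurrence *)

Section PolynomialMaps.
Variable X : nmodType.
Implicit Types (u v : X -> circle) (e : nat).

Definition diff (h : X) u := fun x => u (x + h) - u x.

(* [polymap e u]: [u] is a polynomial map of degree less than [e]. *)
Fixpoint polymap e u : Prop :=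
  if e is e'.+1 then forall h, polymap e' (diff h u) else forall x, u x = 0.

Lemma polymap0 e : polymap e (fun=> 0).
Proof.
elim: e => // e IHe h; suff -> : diff h (fun=> 0) = fun=> 0 by [].
by apply/funext => x; rewrite /diff subrr.
Qed.

Lemma polymap_cst e c : polymap e.+1 (fun=> c).
Proof.
move=> h; suff -> : diff h (fun=> c) = fun=> 0 by exact: polymap0.
by apply/funext => x; rewrite /diff subrr.
Qed.

Lemma polymapS e u : polymap e u -> polymap e.+1 u.
Proof.
elim: e u => [|e IHe] u ue; last by move=> h; apply: IHe.
by move=> h x; rewrite /diff !ue subrr.
Qed.

Lemma polymapB e u v :
  polymap e u -> polymap e v -> polymap e (fun x => u x - v x).
Proof.
elim: e u v => [|e IHe] u v ue ve; first by move=> x; rewrite ue ve subrr.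
move=> h; rewrite (_ : diff h _ = fun x => diff h u x - diff h v x); first exact: IHe.
by apply/funext => x; rewrite /diff !opprB addrACA [RHS]addrACA [- v _ + _]addrC.
Qed.

Lemma polymapN e u : polymap e u -> polymap e (fun x => - u x).
Proof.
move=> /(polymapB (polymap0 e)); congr polymap.
by apply/funext => x; rewrite sub0r.
Qed.

Lemma polymapD e u v :
  polymap e u -> polymap e v -> polymap e (fun x => u x + v x).
Proof.
move=> ue /polymapN /(polymapB ue); congr polymap.
by apply/funext => x; rewrite opprK.
Qed.

Lemma polymap_lim (U : nat_ultrafilter) e (u : nat -> X -> circle) :
  (forall t, polymap e (u t)) -> polymap e (fun x => lim U (u^~ x)).
Proof.
elim: e u => [|e IHe] u ue.
  move=> x; rewrite -[RHS](lim_cst U); congr lim; apply/funext => t; exact: ue.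
move=> h; rewrite (_ : diff h _ = fun x => lim U ((fun t => diff h (u t))^~ x)).
  by apply: IHe => t; apply: ue.
by apply/funext => x; rewrite [RHS](limB U (fun t => u t (x + h)) (fun t => u t x)).
Qed.

End PolynomialMaps.

Section Recurrence.
Variable U : nat_ultrafilter.

(** Induction on the degree. Increments k_0, k_1, ... are chosen with u(a + k_s) close to u(a) +
    u(k_s) for all a up to K_s = k_0 + ... + k_(s-1). Then u(K_s' - K_s) is close to a difference of
    two partial sums of the u(k_l), which is small when both are near their limit. Families are
    needed because the inductive step treats all i and a at once. *)
Lemma polymap_recurrence_family e (I : finType) (u : I -> nat -> circle) (eps : R) :
  (forall i, polymap e.+1 (u i)) -> (forall i, u i 0%N = 0) -> R0 <R eps ->
  exists k, (0 < k)%N /\ forall i, nrm (u i k) <R eps.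
Proof.
elim: e I u eps => [|e IHe] I u eps ue u0 eps0.
  exists 1%N; split=> // i.
  by have := ue i 1%N 0%N; rewrite /diff add0r u0 subr0 => ->; rewrite nrm0.
(* Positivity of [del] stands inside the existential so that [choice] yields a total function. *)
have next K (del : R) : exists k, R0 <R del -> (0 < k)%N /\
    forall i a, (a <= K)%N -> nrm (u i (a + k)%N - u i a - u i k) <R del.
  have [del0|ndel] := pselect (R0 <R del); last by exists 0%N.
  (* As a sequence in k this has a degree bound one lower than [u i], and it vanishes at 0. *)
  pose v (ia : I * 'I_K.+1) k := u ia.1 (k + ia.2)%N - u ia.1 k - u ia.1 ia.2.
  have [||k [k0 hk]] := IHe _ v del _ _ del0.
  - by move=> [i a]; apply: polymapB; [exact: ue|exact: polymap_cst].
  - by move=> [i a]; rewrite /v /= add0n u0 subr0 subrr.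
  exists k => _; split=> // i a aK; have := hk (i, inord a).
  by rewrite /v /= inordK // addnC addrAC.
have [nx hnx] := choice (fun Kd : nat * R => next Kd.1 Kd.2).
(* The tolerances telescope: their total is at most [eps / 2]. *)
pose b s : R := Rdiv eps (Rmult (IZR 2) (INR s.+1)).
have b0 s : R0 <R b s.
  apply: Rdiv_lt_0_compat => //; apply: Rmult_lt_0_compat; first lra.
  by apply: lt_0_INR; exact: PeanoNat.Nat.lt_0_succ.
have bS s : R0 <R Rminus (b s) (b s.+1).
  have h : R0 <R INR s.+1 by apply: lt_0_INR; exact: PeanoNat.Nat.lt_0_succ.
  rewrite /b [INR s.+2]S_INR.
  have -> : Rminus (Rdiv eps (Rmult (IZR 2) (INR s.+1))) (Rdiv eps (Rmult (IZR 2) (Rplus (INR s.+1) R1))) =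
    Rdiv eps (Rmult (IZR 2) (Rmult (INR s.+1) (Rplus (INR s.+1) R1))) by field; lra.
  by apply: Rdiv_lt_0_compat => //; apply: Rmult_lt_0_compat; [lra|apply: Rmult_lt_0_compat; lra].
pose del s := Rminus (b s) (b s.+1).
pose K := fix K s := if s is s'.+1 then (K s' + nx (K s', del s'))%N else 0%N.
pose k s := nx (K s, del s).
have KS s : K s.+1 = (K s + k s)%N by [].
have [kpos hk] : (forall s, (0 < k s)%N) /\ forall s i a, (a <= K s)%N ->
    nrm (u i (a + k s)%N - u i a - u i (k s)) <R del s.
  by split=> s; have [] := hnx (K s, del s) (bS s).
have Kmono s r : (K s <= K (r + s)%N)%N.
  by elim: r => // r IHr; rewrite addSn KS; apply: leq_trans IHr (leq_addr _ _).
pose S i s : circle := \sum_(l < s) u i (k l).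
have claim i s r : nrm (u i (K (r + s)%N - K s)%N - (S i (r + s)%N - S i s))
    <=R Rminus (b s) (b (r + s)%N).
  elim: r => [|r IHr]; first by rewrite add0n subnn u0 subrr subrr nrm0; lra.
  rewrite addSn KS /S big_ord_recr /= -/(S i _) -/(S i _) -addnBAC //.
  set x := (K (r + s)%N - K s)%N in IHr *.
  have hx : (x <= K (r + s)%N)%N by exact: leq_subr.
  have h := hk (r + s)%N i x hx.
  rewrite [_ - S i s]addrAC opprD.
  have := nrmD (u i (x + k (r + s))%N - u i x - u i (k (r + s)%N)) (u i x - (S i (r + s)%N - S i s)).
  have -> : u i (x + k (r + s)%N)%N - u i x - u i (k (r + s)%N) + (u i x - (S i (r + s)%N - S i s))
     = u i (x + k (r + s)%N)%N + (- (S i (r + s)%N - S i s) - u i (k (r + s)%N)).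
    by rewrite [LHS]addrA [X in X + u i x]addrAC subrK -addrA [- u i _ + _]addrC.
  move/Rle_trans; apply; apply: Rle_trans (Rplus_le_compat _ _ _ _ (Rlt_le _ _ h) IHr) _.
  by rewrite /del; lra.
have Unear : U (fun s => forall i, nrm (S i s - lim U (S i)) <R Rdiv eps (IZR 4)).
  by apply: large_forall => i; apply: lim_near; lra.
have [s [_ hs]] := large_unbounded Unear 0%N.
have [s' [ss' hs']] := large_unbounded Unear s.+1.
have es' : s' = (s' - s + s)%N by rewrite subnK // ltnW.
exists (K s' - K s)%N; split.
  rewrite subn_gt0 -(subnK ss') addnS -addSn.
  have -> : (s' - s.+1).+1 = ((s' - s.+1) + 1)%N by rewrite addn1.
  rewrite -addnA; apply: leq_trans (Kmono _ _).
  by rewrite add1n KS -addn1 leq_add2l.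
move=> i; have := claim i s (s' - s)%N; rewrite -es' => h.
have h1 := nrmD (u i (K s' - K s)%N - (S i s' - S i s)) (S i s' - S i s).
rewrite subrK in h1.
have h2 := nrmB (S i s' - lim U (S i)) (S i s - lim U (S i)).
rewrite opprB addrA subrK in h2.
have bs : b s <=R Rdiv eps (IZR 2).
  have h3 : R1 <=R INR s.+1 by rewrite S_INR; have := pos_INR s; lra.
  rewrite /b; apply: Rmult_le_compat_l; first lra.
  by apply: Rinv_le_contravar; lra.
apply: (Rle_lt_trans _ _ _ h1); apply: (Rle_lt_trans _ _ _ (Rplus_le_compat _ _ _ _ h h2)).
apply: (Rlt_le_trans _ _ _ (Rplus_lt_compat_l _ _ _ (Rplus_lt_compat _ _ _ _ (hs' i) (hs i)))).
by have := b0 s'; lra.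
Qed.

Lemma polymap_recurrence e (u : nat -> circle) (eps : R) :
  polymap e u -> R0 <R eps -> exists k, nrm (u k.+1 - u 0%N) <R eps.
Proof.
move=> ue eps0; pose v (_ : 'I_1) k := u k - u 0%N.
have [||[|k] [k0 hk]] // := @polymap_recurrence_family e _ v eps _ _ eps0.
- by move=> i; apply: polymapB; [exact: polymapS|exact: polymap_cst].
- by move=> i; rewrite /v subrr.
- by exists k; apply: (hk ord0).
Qed.

End Recurrence.

(** * Unipotent operators *)

Definition polyp D : {pred int -> circle} := fun q => `[< polymap D q >].

Fact polyp_zmod_closed D : zmod_closed (polyp D).
Proof.
split=> [|u v /asboolP ud /asboolP vd]; apply/asboolP; first exact: polymap0.
exact: polymapB.
Qed.

HB.instance Definition _ D := GRing.isZmodClosed.Build (int -> circle) (polyp D) (polyp_zmod_closed D).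

Record ipoly D := IPoly {ival : int -> circle; ivalP : ival \in polyp D}.

HB.instance Definition _ D := [isSub for @ival D].
HB.instance Definition _ D := [Choice of ipoly D by <:].
HB.instance Definition _ D := [SubChoice_isSubZmodule of ipoly D by <:].

Section Operators.
Variable D : nat.
Local Notation W := (ipoly D).
Implicit Types (q r : W) (j i : nat).

Definition degl j q := polymap j (ival q).

Lemma ivalB q r x : ival (q - r) x = ival q x - ival r x.
Proof. by rewrite -[ival (q - r)]/(\val (q - r)) raddfB. Qed.

Lemma ivalD q r x : ival (q + r) x = ival q x + ival r x.
Proof. by rewrite -[ival (q + r)]/(\val (q + r)) raddfD. Qed.

Lemma degl0 q : degl 0 q -> q = 0.
Proof. by move=> h; apply: val_inj; apply/funext => x; rewrite raddf0; exact: h. Qed.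

Lemma degl_zero j : degl j 0.
Proof. by rewrite /degl -[ival 0]/(\val (0 : W)) raddf0; exact: polymap0. Qed.

Lemma deglB j q r : degl j q -> degl j r -> degl j (q - r).
Proof. by rewrite /degl -[ival (q - r)]/(\val (q - r)) raddfB; exact: polymapB. Qed.

Lemma deglD j q r : degl j q -> degl j r -> degl j (q + r).
Proof. by move=> hq hr; rewrite -[r]opprK; apply: deglB => //; rewrite -sub0r; apply: deglB => //; exact: degl_zero. Qed.

Lemma deglS j q : degl j q -> degl j.+1 q.
Proof. exact: polymapS. Qed.

Lemma degl_top q : degl D q.
Proof. by have /asboolP := ivalP q. Qed.

(** Compatibility with differences amounts to additivity; [uapp_lower] makes the map trivial on the
    quotients of the degree filtration. *)
Record unip := Unip {
  uapp :> W -> W;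
  uappB : forall q r, uapp (q - r) = uapp q - uapp r;
  uapp_lower : forall j q, degl j.+1 q -> degl j (uapp q - q) }.

Lemma unipP (h k : unip) : h =1 k -> h = k.
Proof.
case: h k => [h hB hl] [k kB kl] /= /funext hk; case: _ / hk kB kl => kB kl.
by congr Unip; apply: Prop_irrelevance.
Qed.

Lemma uapp0 (h : unip) : h 0 = 0.
Proof. by have := uappB h 0 0; rewrite !subrr. Qed.

Lemma uappN (h : unip) q : h (- q) = - h q.
Proof. by rewrite -[- q]sub0r uappB uapp0 sub0r. Qed.

Lemma uapp_degl (h : unip) j q : degl j q -> degl j (h q).
Proof.
case: j => [/degl0 ->|j qj]; first by rewrite uapp0; exact: degl_zero.
by rewrite -(subrK q (h q)); apply: deglD => //; apply/deglS/uapp_lower.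
Qed.

(** If [h q = 0], then [h q - q = - q], so the degree bound on [q] descends to 0. *)
Lemma uapp_eq0 (h : unip) q : h q = 0 -> q = 0.
Proof.
move=> hq; suff H j : degl j q -> q = 0 by exact: H (degl_top q).
elim: j => [|j IHj] qj; first exact: degl0.
have := uapp_lower h qj; rewrite hq sub0r => /(deglB (degl_zero j)).
by rewrite sub0r opprK; exact: IHj.
Qed.

Lemma uapp_inj (h : unip) : injective h.
Proof.
by move=> q r e; apply/eqP; rewrite -subr_eq0; apply/eqP/(@uapp_eq0 h); rewrite uappB e subrr.
Qed.

(** Subtract from [q] a preimage of the error [h q - q], which has lower degree. *)
Lemma uapp_surj (h : unip) j q : degl j q -> exists2 r, degl j r & h r = q.
Proof.
elim: j q => [|j IHj] q qj; first by exists q; rewrite // (degl0 qj) uapp0.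
have [r rj hr] := IHj _ (uapp_lower h qj).
by exists (q - r); rewrite ?uappB ?hr ?subKr //; apply: deglB => //; apply: deglS.
Qed.

Definition uid := @Unip id (fun q r => erefl) (fun j q _ => eq_ind_r (degl j) (degl_zero j) (subrr q)).

Fact ucomp_subproof (h k : unip) j q : degl j.+1 q -> degl j ((h \o k) q - q).
Proof.
move=> qj; rewrite /= -(subrKA (k q)).
by apply: deglD; [apply/uapp_lower/uapp_degl|exact: uapp_lower].
Qed.

Definition ucomp (h k : unip) := @Unip (h \o k)
  (fun q r => etrans (congr1 h (uappB k q r)) (uappB h (k q) (k r))) (@ucomp_subproof h k).

Fact uinv_ex (h : unip) : exists k : unip, cancel k h.
Proof.
have [k hk] := choice (fun q => let: ex_intro2 r _ e := uapp_surj h (degl_top q) in ex_intro _ r e).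
have kj j q : degl j q -> degl j (k q).
  by move=> /(uapp_surj h) [r rj hr]; rewrite (_ : k q = r) //; apply: (@uapp_inj h); rewrite hk.
have kB q r : k (q - r) = k q - k r by apply: (@uapp_inj h); rewrite uappB !hk.
have kl j q : degl j.+1 q -> degl j (k q - q).
  move=> /kj qj; have := uapp_lower h qj; rewrite hk => /(deglB (degl_zero j)).
  by rewrite sub0r opprB.
by exists (Unip kB kl).
Qed.

Definition uinv h := projT1 (cid (uinv_ex h)).

Lemma uinvK h : cancel (uinv h) h.
Proof. exact: (projT2 (cid (uinv_ex h))). Qed.

HB.instance Definition _ := gen_eqMixin unip.
HB.instance Definition _ := gen_choiceMixin unip.

Fact ucompA : associative ucomp.
Proof. by move=> h k l; apply: unipP. Qed.
Fact ucomp1 : left_id uid ucomp.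
Proof. by move=> h; apply: unipP. Qed.
Fact ucomp1r : right_id uid ucomp.
Proof. by move=> h; apply: unipP. Qed.
Fact ucompV : right_inverse uid uinv ucomp.
Proof. by move=> h; apply: unipP => q; exact: uinvK. Qed.
Fact ucompVl : left_inverse uid uinv ucomp.
Proof. by move=> h; apply: unipP => q; apply: (@uapp_inj h); exact: uinvK. Qed.

HB.instance Definition _ := isGroup.Build unip ucompA ucomp1 ucomp1r ucompVl ucompV.

Lemma uappM (h k : unip) q : (h * k)%g q = h (k q).
Proof. by []. Qed.

Lemma uapp1 q : (1%g : unip) q = q.
Proof. by []. Qed.

Lemma uappKV (h : unip) q : h (h^-1%g q) = q.
Proof. exact: uinvK. Qed.

Definition lowers i (h : unip) := forall j q, degl (j + i) q -> degl j (h q - q).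

Lemma lowers_top h : lowers D h -> h = 1%g.
Proof.
move=> hD; apply: unipP => q; apply/eqP; rewrite -subr_eq0; apply/eqP/degl0.
by apply: hD; exact: degl_top.
Qed.

(** With A = a - 1 and Z = z - 1, the commutator minus 1 is z^-1 (A Z - Z A) a^-1, and both products
    lower the degree by i + 1. *)
Lemma lowers_commutator i (a z : unip) :
  lowers i z -> lowers i.+1 (z^-1 * (a * z * a^-1))%g.
Proof.
move=> zi j q qj; rewrite !uappM; set r := a^-1%g q.
have rj : degl (j + i).+1 r by rewrite -addnS; exact: uapp_degl.
have -> : z^-1%g (a (z r)) - q = z^-1%g (a (z r) - z (a r)).
  by rewrite uappB -[X in _ = _ - X]uappM mulVg uapp1 uappKV.
have -> : a (z r) - z (a r) = (a (z r - r) - (z r - r)) - (z (a r - r) - (a r - r)).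
  have E (x y w v : W) : x - y - (w - v) = (x + v) - (y + w) by rewrite opprB addrACA -opprD.
  by rewrite !uappB E subrKA [z r - r + _]addrC subrKA opprB addrA subrK.
apply/uapp_degl/deglB; first by apply/uapp_lower/zi; rewrite addSn.
by apply/zi/uapp_lower.
Qed.

(* Expanding the iterated commutator of [x] with the [c b], [b] in [bs], as a word in the
   conjugates of [x] by products of the [c b] shows the full conjugate exactly once. *)
Lemma conjugate_expansion (T : eqType) (c : T -> unip) (x : unip) i (bs : seq T)
    (H : unip -> Prop) :
  lowers i x -> H 1%g -> (forall h k, H h -> H k -> H (h * k)%g) -> (forall h, H h -> H h^-1%g) ->
  (forall s, subseq s bs -> s != bs ->
    H ((\prod_(b <- s) c b) * x * (\prod_(b <- s) c b)^-1)%g) ->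
  exists2 v, H v &
    lowers (i + size bs) (v * ((\prod_(b <- bs) c b) * x * (\prod_(b <- bs) c b)^-1))%g.
Proof.
move=> xi; elim: bs H => [|b bs IHbs] H H1 HM HV Hs.
  by exists 1%g => //; rewrite big_nil mul1g invg1 mul1g mulg1 addn0.
(* The induction hypothesis for [K] handles the conjugates along [s] and along [b :: s] together. *)
pose K h := H h /\ H (c b * h * (c b)^-1)%g.
have conjM (h k : unip) : (c b * (h * k) * (c b)^-1 = (c b * h * (c b)^-1) * (c b * k * (c b)^-1))%g.
  by rewrite !mulgA mulgVK.
have conjE s : (c b * ((\prod_(a <- s) c a) * x * (\prod_(a <- s) c a)^-1) * (c b)^-1 =
    (\prod_(a <- b :: s) c a) * x * (\prod_(a <- b :: s) c a)^-1)%g.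
  by rewrite big_cons invgM !mulgA.
have [||||v [Hv Hcv] vl] := IHbs K.
- by split; rewrite // mulg1 mulgV.
- by move=> h k [? ?] [? ?]; split; rewrite ?conjM; apply: HM.
- by move=> h [Hh /HV]; rewrite !invgM invgK mulgA; split=> //; exact: HV.
- move=> s sbs ns; split; last first.
    by rewrite conjE; apply: Hs; rewrite /= ?eqxx // eqseq_cons eqxx.
  apply: Hs; first exact: subseq_trans sbs (subseq_cons _ _).
  by apply: contraTneq (size_subseq sbs) => ->; rewrite -ltnNge.
pose X := ((\prod_(a <- bs) c a) * x * (\prod_(a <- bs) c a)^-1)%g.
rewrite -/X in vl.
(* Multiplied by the conjugate of [X] by [c b], this is the commutator of [v * X] with [c b], which
   gains one degree. *)
exists (X^-1 * v^-1 * (c b * v * (c b)^-1))%g.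
  apply: (HM) => //; apply: (HM); last exact: (HV).
  apply: (HV); rewrite /X; apply: Hs; first exact: subseq_cons.
  by apply/eqP => /(congr1 size) /= /n_Sn.
rewrite -conjE -/X -mulgA -conjM addnS -invgM.
exact: lowers_commutator.
Qed.

End Operators.

(** * Approximable operators and shift limits *)

Section Approximation.
Variables (U : nat_ultrafilter) (D : nat).
Local Notation W := (ipoly D).
Local Notation unip := (unip D).

Definition subtractive (psi : W -> circle) := forall q r, psi (q - r) = psi q - psi r.

Lemma subtractive_unip (psi : W -> circle) (h : unip) :
  subtractive psi -> subtractive (psi \o h).
Proof. by move=> psiB q r; rewrite /= uappB psiB. Qed.

(** A weak closure of [M]: one value [psi (h q)] is approximated at a time. Since [psi] is any
    additive functional, it can absorb an operator already chosen; this gives closure under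
    products. *)
Definition approx (M : unip -> Prop) (h : unip) :=
  forall psi, subtractive psi -> forall q eps, R0 <R eps ->
  exists2 m, M m & nrm (psi (m q) - psi (h q)) <R eps.

Variable M : unip -> Prop.
Hypothesis M1 : M 1%g.
Hypothesis MM : forall m m', M m -> M m' -> M (m * m')%g.

Lemma approx_refl m : M m -> approx M m.
Proof. by move=> Mm psi psiB q eps eps0; exists m; rewrite // subrr nrm0. Qed.

Lemma approxM h k : approx M h -> approx M k -> approx M (h * k)%g.
Proof.
move=> hh hk psi psiB q eps eps0.
have e2 : R0 <R Rdiv eps (IZR 2) by lra.
have [m Mm hm] := hh psi psiB (k q) _ e2.
have [m' Mm' hm'] := hk _ (subtractive_unip m psiB) q _ e2.
exists (m * m')%g; first exact: MM.
by have := nrm_trans hm' hm; rewrite Rplus_half_diag.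
Qed.

Lemma approxX h k : approx M h -> approx M (h ^+ k)%g.
Proof.
move=> hh; elim: k => [|k IHk]; first by rewrite expg0; apply: approx_refl.
by rewrite expgS; apply: approxM.
Qed.

(** The difference in k with step s is the same kind of sequence for [(h ^+ s) q - q], which has
    lower degree. *)
Lemma polymap_expg psi h j q : subtractive psi -> degl j q ->
  polymap j (fun k : nat => psi (uapp (h ^+ k)%g q)).
Proof.
move=> psiB; elim: j q => [|j IHj] q qj.
  by move=> k; rewrite (degl0 qj) uapp0 -(subrr 0) psiB subrr.
move=> s; have := IHj _ (uapp_lower (h ^+ s : unip)%g qj); congr polymap.
by apply/funext => k; rewrite /diff uappB psiB -uappM -expgnDr.
Qed.

(** The sequence psi(h^k (h^-1 q)) comes back near its start at some time k + 1, where its value is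
    psi(h^k q); and the power h^k is approximable. *)
Lemma approxV h : approx M h -> approx M (h^-1)%g.
Proof.
move=> hh psi psiB q eps eps0; have e2 : R0 <R Rdiv eps (IZR 2) by lra.
have [k] := polymap_recurrence U (polymap_expg h psiB (degl_top (h^-1%g q))) e2.
rewrite expgSr uappM uappKV expg0 uapp1 => hk.
have [m Mm hm] := approxX k hh psiB q e2.
by exists m => //; have := nrm_trans hm hk; rewrite Rplus_half_diag.
Qed.

End Approximation.

Section ShiftLimits.
Variables (U : nat_ultrafilter) (D : nat).
Local Notation W := (ipoly D).
Implicit Type c : nat -> int.

Lemma polymap_shift_lim c j (q : int -> circle) :
  polymap j.+1 q -> polymap j (fun x => lim U (fun t => q (x + c t)) - q x).
Proof.
move=> qj; have := polymap_lim U (fun t => qj (c t)); congr polymap.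
by apply/funext => x; rewrite /diff limB lim_cst.
Qed.

Fact shift_lim_subproof c (q : W) : (fun x => lim U (fun t => ival q (x + c t))) \in polyp D.
Proof.
apply/asboolP; have /asboolP qD := ivalP q.
have := polymapD (polymap_shift_lim c (polymapS qD)) qD; congr polymap.
by apply/funext => x; rewrite subrK.
Qed.

Definition shift_fun c q : W := IPoly (shift_lim_subproof c q).

Fact shift_funB c q r : shift_fun c (q - r) = shift_fun c q - shift_fun c r.
Proof.
apply: val_inj; apply/funext => x; by rewrite [RHS]ivalB /= -limB; congr lim.
Qed.

Fact shift_fun_lower c j q : degl j.+1 q -> degl j (shift_fun c q - q).
Proof.
exact: polymap_shift_lim.
Qed.

Definition shiftop c : unip D := Unip (shift_funB c) (@shift_fun_lower c).

Lemma shiftopE c q x : ival (shiftop c q) x = lim U (fun t => ival q (x + c t)).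
Proof. by []. Qed.

(* The reason: [shiftop] is additive in [c] modulo operators lowering the degree by 2. *)
Lemma lowers_shiftopV c : lowers 2 (shiftop c * shiftop (fun t => - c t))%g.
Proof.
move=> j q qj; rewrite uappM; set b := shiftop c; set b' := shiftop _.
have -> : b (b' q) - q = (b (b' q - q) - (b' q - q)) + ((b q - q) + (b' q - q)).
  by rewrite uappB [b q - q + _]addrC subrKA subrKA.
apply: deglD; first by apply/uapp_lower/uapp_lower; rewrite -addn2.
rewrite /degl (_ : ival _ = fun x => lim U ((fun t x => - (diff (c t) (diff (- c t) (ival q)) x))^~ x)).
  by apply: polymap_lim => t; apply: polymapN; move: qj; rewrite addn2; apply.
apply/funext => x; rewrite ivalD !ivalB !shiftopE.
rewrite [RHS](_ : _ = lim U (fun t => (ival q (x - c t) - ival q x) - (ival q x - ival q (x + c t)))).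
  by rewrite !limB !lim_cst opprB addrC.
by congr lim; apply/funext => t; rewrite /diff addrK opprB.
Qed.

End ShiftLimits.

(** * Words of class sets *)

Section Words.
Variables (U : nat_ultrafilter) (e : nat) (n : nat -> nat).
Local Notation W := (ipoly e.+2).
Implicit Types (S : {set 'I_e.+1}) (b : 'I_e.+1) (s : seq 'I_e.+1) (l : seq {set 'I_e.+1}).

(** The number d of classes is [e.+1]; degree at most d is then [polymap e.+2]. *)
Definition cls (i : nat) : 'I_e.+1 := inZp i.

(** Counting index 0 is harmless: only increments between positive break points enter the final
    sums. *)
Definition weight S t : int := (\sum_(i <- iota 0 t | cls i \in S) n i)%N.

Definition arrow S S' : unip e.+2 := shiftop U e.+2 (fun t => weight S t - weight S' t).

(** The first arrow is the outermost limit, so its break point is fixed first. *)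
Fixpoint word_op S l : unip e.+2 :=
  if l is S' :: l' then (arrow S S' * word_op S' l')%g else 1%g.

Definition meets S S' := S :&: S' != set0.

Definition add_class b : unip e.+2 := shiftop U e.+2 (weight [set b]).

Lemma weight0 t : weight set0 t = 0.
Proof. by rewrite /weight big_pred0 // => i; rewrite in_set0. Qed.

Lemma weightD1 S b t : b \in S -> weight S t = weight [set b] t + weight (S :\ b) t.
Proof.
move=> bS; rewrite /weight (bigID (fun i => cls i == b)) /= PoszD; congr (Posz _ + Posz _).
  apply: eq_bigl => i; rewrite in_set1; case: eqP => [->|]; rewrite ?andbT ?andbF ?bS //.
by apply: eq_bigl => i; rewrite in_setD1 andbC.
Qed.

(** The weights of the other classes cancel, so the arrow depends on [b] alone and not on [S]. *)
Lemma arrow_del S b : b \in S -> arrow S (S :\ b) = add_class b.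
Proof.
by move=> bS; congr shiftop; apply/funext => t; rewrite (weightD1 t bS) addrK.
Qed.

Lemma arrow_ins S b : b \in S -> arrow (S :\ b) S = shiftop U e.+2 (fun t => - weight [set b] t).
Proof.
by move=> bS; congr shiftop; apply/funext => t; rewrite (weightD1 t bS) opprD addrC subrK.
Qed.

Lemma word_op_cat S l l' : word_op S (l ++ l') = (word_op S l * word_op (last S l) l')%g.
Proof. by elim: l S => [|S' l IHl] S /=; rewrite ?mul1g // IHl mulgA. Qed.

Fixpoint downs S s := if s is b :: s' then (S :\ b) :: downs (S :\ b) s' else [::].

Lemma last_downs S s : last S (downs S s) = S :\: [set b in s].
Proof.
elim: s S => [|b s IHs] S /=; first by rewrite set_nil setD0.
by rewrite IHs set_cons setDDl.
Qed.

Lemma path_downs S s : S :\: [set b in s] != set0 -> path meets S (downs S s).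
Proof.
elim: s S => [|b s IHs] S //=; rewrite set_cons -setDDl => ne.
rewrite IHs // andbT /meets (setIidPr (subD1set _ _)).
by apply: contraNneq ne => ->; rewrite set0D.
Qed.

Lemma word_op_downs S s : uniq s -> {subset s <= S} ->
  word_op S (downs S s) = (\prod_(b <- s) add_class b)%g.
Proof.
elim: s S => [|b s IHs] S /=; first by rewrite big_nil.
move=> /andP [bs us] sS; rewrite big_cons arrow_del; last by apply: sS; rewrite mem_head.
rewrite IHs // => c cs; rewrite !inE sS ?inE ?cs ?orbT // andbT.
by apply: contraTneq cs => ->.
Qed.

Definition loop h := exists l, [/\ path meets setT l, last setT l = setT & h = word_op setT l].

Lemma loop1 : loop 1%g.
Proof. by exists [::]. Qed.

Lemma loopM h h' : loop h -> loop h' -> loop (h * h')%g.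
Proof.
move=> [l [pl ll ->]] [l' [pl' ll' ->]]; exists (l ++ l').
by split; rewrite ?cat_path ?last_cat ?word_op_cat ?ll ?pl.
Qed.

Definition others : seq 'I_e.+1 := enum [set~ ord0].

Lemma others_uniq : uniq others.
Proof. exact: enum_uniq. Qed.

Lemma size_others : size others = e.
Proof. by rewrite -cardE cardsC1 card_ord. Qed.

Lemma mem_others b : (b \in others) = (b != ord0).
Proof. by rewrite mem_enum !inE. Qed.

(* The loop that leaves out the class [0] and takes it back. *)
Definition detour : unip e.+2 :=
  (add_class ord0 * shiftop U e.+2 (fun t => - weight [set ord0] t)%R)%g.

(** Let y lead from the full set down to S, and let z jump back. The loops y detour z and y z have
    quotient y detour y^-1. The detour is a legal part of a word because S keeps a class other than
    0. *)
Lemma conjugate_detour_approx s : subseq s others -> s != others ->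
  approx loop ((\prod_(b <- s) add_class b) * detour * (\prod_(b <- s) add_class b)^-1)%g.
Proof.
move=> ss ns; have us := subseq_uniq ss others_uniq.
have so := mem_subseq ss.
set S := setT :\: [set b in s].
have S0 : ord0 \in S.
  by rewrite !inE andbT; apply/negP => /so; rewrite mem_others eqxx.
have [c cS] : exists c, c \in S :\ ord0.
  have [c co cs] : exists2 c, c \in others & c \notin s.
    apply/allPn; apply: contra ns => /allP os.
    by rewrite -(size_subseq_leqif ss).2 eqn_leq size_subseq // uniq_leq_size // others_uniq.
  by exists c; rewrite !inE -mem_others co cs.
have Sn0 : S != set0 by apply/set0Pn; exists ord0.
have Sm : meets S (S :\ ord0) by rewrite /meets (setIidPr (subD1set _ _)); apply/set0Pn; exists c.
have St : meets S setT by rewrite /meets setIT.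
have dE : word_op setT (downs setT s) = (\prod_(b <- s) add_class b)%g by rewrite word_op_downs // => b; rewrite inE.
rewrite -dE; set y := word_op _ _; pose z := arrow S setT.
have L1 : loop (y * (detour * z))%g.
  exists (downs setT s ++ [:: S :\ ord0; S; setT]).
  rewrite cat_path last_cat word_op_cat last_downs -/S /= path_downs //.
  split=> //; last by rewrite arrow_del // arrow_ins // mulg1 /detour -!mulgA.
  by apply/and5P; split=> //; rewrite /meets setIC.
have L2 : loop (y * z)%g.
  exists (downs setT s ++ [:: setT]).
  by rewrite cat_path last_cat word_op_cat last_downs -/S /= path_downs // St mulg1.
rewrite (_ : (y * detour * y^-1 = (y * (detour * z)) * (y * z)^-1)%g).
  apply: approxM; [exact: loopM|exact: approx_refl|].
  by apply: (approxV U); [exact: loop1|exact: loopM|exact: approx_refl].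
by rewrite invgM !mulgA mulgK.
Qed.

Lemma full_conjugate_detour_approx :
  approx loop ((\prod_(b <- others) add_class b) * detour * (\prod_(b <- others) add_class b)^-1)%g.
Proof.
have aM := approxM loopM; have aV := approxV U loop1 loopM.
have [v va] := conjugate_expansion (@lowers_shiftopV U e.+2 (weight [set ord0]))
  (approx_refl loop1) aM aV conjugate_detour_approx.
(* As 2 + (d - 1) = d + 1 is the degree bound [e.+2], the product of [v] with the full conjugate is
   1. *)
rewrite size_others => /lowers_top vX.
by rewrite -[X in approx _ X](mulKg v) vX mulg1; exact: aV.
Qed.

(** The middle of the word is a loop approximating (y z)^-1 (y detour y^-1)^-1. Between b' z and y
    [add_class ord0] this leaves b' detour^-1 [add_class ord0], which is 1 because detour is
    [add_class ord0] times b'. *)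
Lemma word_recurrence (q : W) (eps : R) : R0 <R eps ->
  exists2 l, path meets [set ord0] l &
    nrm (ival (word_op set0 ([set ord0] :: rcons l set0) q) 0 - ival q 0) <R eps.
Proof.
move=> eps0; set a := [set ord0].
pose b' := shiftop U e.+2 (fun t => - weight a t)%R.
pose y := (\prod_(b <- others) add_class b)%g; pose z := arrow a setT.
have lastE : last setT (downs setT others) = a.
  by rewrite last_downs; apply/setP => b; rewrite !inE mem_others negbK andbT.
have yE : word_op setT (downs setT others) = y.
  by apply: word_op_downs => [|b]; [exact: others_uniq|rewrite inE].
have a0 : a != set0 by apply/set0Pn; exists ord0; rewrite inE.
have py : path meets setT (downs setT others) by apply: path_downs; rewrite -last_downs lastE.
have yz : loop (y * z)%g.
  exists (downs setT others ++ [:: setT]).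
  by rewrite cat_path last_cat word_op_cat yE lastE /= py /meets setIT a0 mulg1.
have aM := approxM loopM; have aV := approxV U loop1 loopM.
have happ := aM _ _ (aV _ (approx_refl yz)) (aV _ full_conjugate_detour_approx).
pose psi (r : W) := ival ((b' * z)%g r) 0.
have psiB : subtractive psi by move=> r r'; rewrite /psi uappB ivalB.
have [m [l [pl ll ->]]] := happ _ psiB ((y * add_class ord0)%g q) _ eps0.
have aD : a :\ ord0 = set0 by rewrite /a setDv.
have -> : psi (((y * z)^-1 * (y * detour * y^-1)^-1)%g ((y * add_class ord0)%g q)) = ival q 0.
  rewrite /psi -2!uappM; suff -> : (b' * z * ((y * z)^-1 * (y * detour * y^-1)^-1) * (y * add_class ord0) = 1)%g by [].
  by rewrite /detour -/a -/b' !invgM invgK !mulgA mulgK !mulgVK mulgV.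
move=> hm; exists (setT :: l ++ downs setT others).
  by rewrite /= /meets setIT a0 cat_path pl ll py.
have bE : arrow set0 a = b' by rewrite -{1}aD arrow_ins // inE.
have cE : arrow a set0 = add_class ord0 by rewrite -aD arrow_del // inE.
have -> : word_op set0 (a :: rcons (setT :: l ++ downs setT others) set0) =
    (b' * (z * (word_op setT l * (y * add_class ord0))))%g.
  by rewrite /= rcons_cat word_op_cat ll -cats1 word_op_cat yE lastE /= mulg1 bE cE.
exact: hm.
Qed.

End Words.

(** * From words to sets with bounded gaps *)

Section Realization.
Variables (U : nat_ultrafilter) (e : nat) (n : nat -> nat).
Local Notation W := (ipoly e.+2).
Implicit Types (S : {set 'I_e.+1}) (l : seq {set 'I_e.+1}) (al : seq nat).

Lemma next_in_class (i : nat) (c : 'I_e.+1) :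
  exists j, [/\ (i < j)%N, (j <= i + e.+1)%N & cls e j = c].
Proof.
pose r := (i.+1 %% e.+1)%N; have r1 : (r < e.+1)%N by rewrite ltn_pmod.
pose k := (c + (e.+1 - r)) %% e.+1; have k1 : (k < e.+1)%N by rewrite ltn_pmod.
exists (i.+1 + k)%N; split; [exact: leq_addr|lia|].
apply: val_inj => /=; rewrite modnDmr -modnDml -/r.
by rewrite (_ : (r + (c + (e.+1 - r)) = c + e.+1)%N) ?modnDr ?modn_small //; lia.
Qed.

Lemma cls_period i : cls e (i + e.+1) = cls e i.
Proof. by apply: val_inj; rewrite /= modnDr. Qed.

Definition block S t t' := [seq i <- iota t (t' - t) | cls e i \in S].

Lemma mem_block S t t' i : (i \in block S t t') = [&& cls e i \in S, t <= i & i < t']%N.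
Proof.
rewrite mem_filter mem_iota; case: (leqP t t') => tt'; first by rewrite subnKC.
by rewrite (eqP (ltnW tt' : (t' - t == 0)%N)) addn0; congr (_ && _); lia.
Qed.

Lemma weight_block S t t' : (t <= t')%N ->
  weight n S t' = weight n S t + (\sum_(i <- block S t t') n i)%N.
Proof. by move=> tt'; rewrite /weight -{1}(subnKC tt') iotaD big_cat /= PoszD big_filter. Qed.

(* [al] may be continued from [t] on by a block with the class set [S] without
   creating a gap larger than [e.+1]. *)
Definition extendable al t S := forall i, i \in al ->
  exists j, [/\ (i < j)%N, (j <= i + e.+1)%N & j \in al \/ (t <= j)%N /\ cls e j \in S].

Definition bounded_gaps al := forall i, i \in al ->
  (forall j, j \in al -> (j <= i)%N) \/
  exists j, [/\ j \in al, (i < j)%N & (j <= i + e.+1)%N].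

Definition within al t := uniq al /\ forall i, i \in al -> (0 < i < t)%N.

Lemma within_block al S t t' : (0 < t <= t')%N -> within al t -> within (al ++ block S t t') t'.
Proof.
move=> /andP [t0 tt'] [ual alt]; split; last first.
  by move=> i; rewrite mem_cat mem_block => /orP [/alt|]; lia.
rewrite cat_uniq ual filter_uniq ?iota_uniq // andbT; apply/hasPn => i.
by rewrite mem_block => /and3P [_ ti _]; apply/negP => /alt; lia.
Qed.

(** The block has length at least d, so it contains every successor promised to an element of [al].
    An element of the block is followed within distance d by an index of a class common to [S] and
    [S'], usable on either side of t'. *)
Lemma extendable_block al S S' t t' : (t + e.+1 <= t')%N -> meets S S' ->
  within al t -> extendable al t S -> extendable (al ++ block S t t') t' S'.
Proof.
move=> tt' /set0Pn [c]; rewrite inE => /andP [cS cS'] [_ alt] ext i.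
rewrite mem_cat => /orP [ial|].
  have := alt i ial; have [j [ij ji [jal|[tj jS]]]] := ext i ial => it.
    by exists j; rewrite mem_cat jal; split=> //; left.
  exists j; split=> //; left; rewrite mem_cat mem_block jS tj (_ : j < t')%N ?orbT //; lia.
rewrite mem_block => /and3P [iS ti it'].
have [j [ij ji jc]] := next_in_class i c; exists j; split=> //.
case: (ltnP j t') => jt'; [left|right; rewrite jc //].
by rewrite mem_cat mem_block jc cS jt' (_ : t <= j)%N ?orbT //; lia.
Qed.

(** In the last block i + d has the class of i. If it lies past the end, any later element is within
    distance d of i. *)
Lemma bounded_gaps_block al S t t' : (t + e.+1 <= t')%N ->
  within al t -> extendable al t S -> bounded_gaps (al ++ block S t t').
Proof.
move=> tt' [_ alt] ext i; rewrite mem_cat => /orP [ial|].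
  right; have := alt i ial; have [j [ij ji [jal|[tj jS]]]] := ext i ial => it.
    by exists j; rewrite mem_cat jal.
  exists j; split=> //; rewrite mem_cat mem_block jS tj (_ : j < t')%N ?orbT //; lia.
rewrite mem_block => /and3P [iS ti it'].
case: (ltnP (i + e.+1) t') => h.
  right; exists (i + e.+1)%N; split=> //; last by lia.
  by rewrite mem_cat mem_block cls_period iS h (_ : t <= i + e.+1)%N ?orbT //; lia.
have [/allP hmax|/allPn [j jal]] := boolP (all (fun j => j <= i)%N (al ++ block S t t')); first by left.
rewrite -ltnNge => ij; right; exists j; split=> //.
by move: jal; rewrite mem_cat mem_block => /orP [/alt|]; lia.
Qed.

(** Induction on the word. The argument of [q] stays the sum chosen so far minus the weight of the
    current class set; each limit supplies a far break point closing the next block, and the final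
    empty set has weight 0. *)
Lemma realization l S al t (q : W) (eps : R) :
  path (@meets e) S l -> S != set0 -> (0 < t)%N -> within al t -> extendable al t S ->
  nrm (ival (word_op U n S (rcons l set0) q) (Posz (\sum_(i <- al) n i)%N - weight n S t)) <R eps ->
  exists be, [/\ be != [::], exists t', within be t', bounded_gaps be &
    nrm (ival q (\sum_(i <- be) n i)%N) <R eps].
Proof.
have sum_block bl S' t1 t2 S2 : (t1 <= t2)%N ->
    Posz (\sum_(i <- bl) n i)%N - weight n S' t1 + (weight n S' t2 - weight n S2 t2)
    = Posz (\sum_(i <- bl ++ block S' t1 t2) n i)%N - weight n S2 t2.
  by move=> t12; rewrite (weight_block _ t12) big_cat /= PoszD; lia.
elim: l S al t q => [|S' l IHl] S al t q /=.
  move=> _ /set0Pn [c cS] t0 wal ext /nrm_lim_lt/large_unbounded/(_ (t + e.+1)%N) [t' [tt']].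
  have tt1 : (t <= t')%N by lia.
  rewrite sum_block // weight0 subr0 => hq; exists (al ++ block S t t'); split=> //.
  - have [j [ij ji jc]] := next_in_class t.-1 c.
    have : j \in al ++ block S t t'.
      by rewrite mem_cat mem_block jc cS (_ : t <= j < t')%N ?orbT //; lia.
    by apply: contraTneq => ->.
  - by exists t'; apply: within_block; rewrite ?t0.
  - exact: bounded_gaps_block.
move=> /andP [SS' pl] S0 t0 wal ext /nrm_lim_lt/large_unbounded/(_ (t + e.+1)%N) [t' [tt']].
have tt1 : (t <= t')%N by lia.
rewrite sum_block //; apply: IHl => //.
- by apply/set0Pn; case/set0Pn: SS' => c; rewrite inE => /andP [_]; exists c.
- by lia.
- by apply: within_block; rewrite ?t0.
- exact: extendable_block.
Qed.

Lemma bounded_gap_recurrence (q : W) (eps : R) : R0 <R eps ->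
  nrm (ival q 0) = R0 ->
  exists be, [/\ be != [::], exists t, within be t, bounded_gaps be &
    nrm (ival q (\sum_(i <- be) n i)%N) <R eps].
Proof.
move=> eps0 q0; have [l pl] := word_recurrence U n q eps0.
have -> : ival q 0 = 0 by exact: nrm_eq0.
(* The arrow from the empty set to {0} only supplies the first break point, taken positive to keep
   index 0 out. *)
rewrite subr0 => /nrm_lim_lt/large_unbounded/(_ 1%N) [t [t0]].
rewrite weight0 sub0r add0r => h.
apply: (realization pl _ t0 (_ : within [::] t)) => //.
- by apply/set0Pn; exists ord0; rewrite inE.
- by rewrite big_nil sub0r.
Qed.

End Realization.

(** * Real polynomials *)

Definition real_poly e (f : R -> R) := exists a, forall x, f x = poly_eval a e x.

Lemma poly_evalS a e x :
  poly_eval a e.+1 x = Rplus (a 0%N) (Rmult x (poly_eval (fun k => a k.+1) e x)).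
Proof.
rewrite /poly_eval decomp_sum /=; last exact: PeanoNat.Nat.lt_0_succ.
by rewrite Rmult_1_r scal_sum; congr Rplus; apply: PartSum.sum_eq => k _; ring.
Qed.

Lemma real_polyD e f g :
  real_poly e f -> real_poly e g -> real_poly e (fun x => Rplus (f x) (g x)).
Proof.
move=> [a fa] [b gb]; exists (fun k => Rplus (a k) (b k)) => x.
by rewrite fa gb /poly_eval -sum_plus; apply: PartSum.sum_eq => k _; ring.
Qed.

Lemma real_polyZ e c f : real_poly e f -> real_poly e (fun x => Rmult c (f x)).
Proof.
move=> [a fa]; exists (fun k => Rmult c (a k)) => x.
by rewrite fa /poly_eval scal_sum; apply: PartSum.sum_eq => k _; ring.
Qed.

Lemma real_polyX e f : real_poly e f -> real_poly e.+1 (fun x => Rmult x (f x)).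
Proof.
move=> [a fa]; exists (fun k => if k is k'.+1 then a k' else R0) => x.
by rewrite fa poly_evalS Rplus_0_l.
Qed.

Lemma real_polyS e f : real_poly e f -> real_poly e.+1 f.
Proof.
move=> [a fa]; exists (fun k => if (k <= e)%N then a k else R0) => x.
rewrite fa /poly_eval tech5 ltnn Rmult_0_l Rplus_0_r.
by apply: PartSum.sum_eq => k /leP ->.
Qed.

(** For p = a_0 + x f and D the difference with step h, D p = x D f + h f + h D f, and D f is known
    by induction. *)
Lemma real_poly_diff e f h : real_poly e.+1 f ->
  real_poly e (fun x => Rminus (f (Rplus x h)) (f x)).
Proof.
move=> [a fa]; suff [b hb] : real_poly e (fun x => Rminus (poly_eval a e.+1 (Rplus x h)) (poly_eval a e.+1 x)).
  by exists b => x; rewrite !fa hb.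
elim: e a {f fa} => [|e IHe] a.
  by exists (fun=> Rmult (a 1%N) h) => x; rewrite /poly_eval /=; ring.
set f := poly_eval (fun k => a k.+1) e.+1.
have fe : real_poly e.+1 f by exists (fun k => a k.+1).
have de := IHe (fun k => a k.+1); rewrite -/f in de.
have [b hb] := real_polyD (real_polyX de) (real_polyD (real_polyZ h fe) (real_polyZ h (real_polyS de))).
by exists b => x; rewrite -hb !(@poly_evalS a) -/f; ring.
Qed.

Definition int_to_R (z : int) : R := IZR (ssrZ.Z_of_int z).

Lemma int_to_RD x y : int_to_R (x + y) = Rplus (int_to_R x) (int_to_R y).
Proof. by rewrite -plus_IZR; congr IZR; lia. Qed.

Lemma real_poly_polymap e f :
  real_poly e f -> polymap e.+1 (fun z : int => proj (f (int_to_R z))).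
Proof.
elim: e f => [|e IHe] f fe.
  have [a fa] := fe; rewrite (_ : (fun z => _) = fun=> proj (a 0%N)); first exact: polymap_cst.
  by apply/funext => z; rewrite fa /poly_eval /= Rmult_1_r.
move=> h; have := IHe _ (real_poly_diff (int_to_R h) fe); congr polymap.
by apply/funext => z; rewrite /diff int_to_RD projB.
Qed.

Lemma sum_over_big n al : sum_over n al = (\sum_(i <- al) n i)%N.
Proof. by rewrite unlock /sum_over; elim: al => //= i al ->. Qed.

Lemma mem_In (T : eqType) (s : seq T) x : List.In x s <-> x \in s.
Proof.
elim: s => //= y s IHs; rewrite inE; split=> [[->|/IHs ->]|/predU1P [->|/IHs]]; rewrite ?eqxx ?orbT //; by [left|right].
Qed.

Lemma uniq_NoDup (T : eqType) (s : seq T) : uniq s -> List.NoDup s.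
Proof.
elim: s => [|x s IHs] /=; first by constructor.
by move=> /andP [xs /IHs]; constructor => //; apply/mem_In/negP.
Qed.

Lemma bounded_gap_poly_recurrence (a : nat -> R) (d : nat) (n : nat -> nat) (eps : R) :
  Peano.le 1 d -> poly_eval a d R0 = R0 -> R0 <R eps ->
  exists al, [/\ finset_pos al, in_S d al & dist_Z (poly_eval a d (INR (sum_over n al))) <=R eps].
Proof.
case: d => [/PeanoNat.Nat.nle_succ_0 //|e] _ a0 eps0.
have [U] := nat_ultrafilter_ex.
have qP : (fun z => proj (poly_eval a e.+1 (int_to_R z))) \in polyp e.+2.
  by apply/asboolP/real_poly_polymap; exists a.
have q0 : nrm (ival (IPoly qP) 0) = R0.
  by rewrite /= /int_to_R /= a0 nrm0.
have [al [al0 [t [ual alt]] gaps hq]] := bounded_gap_recurrence U n eps0 q0.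
exists al; split.
- by split; [exact: uniq_NoDup|move=> i /mem_In /alt /andP [/ltP]].
- split; first by move/eqP: al0.
  move=> i /mem_In /gaps [h|[j [/mem_In jal /ltP ij /leP ji]]].
    by left=> j /mem_In /h /leP.
  by right; exists j.
by apply: Rlt_le; move: hq; rewrite /= nrm_proj sum_over_big INR_IZR_INZ.
Qed.

End BoundedGaps.

Theorem theoremA (a : nat -> R) (d : nat) (n : nat -> nat)
  (hd : (1 <= d)%nat) (hdeg : a d <> 0) (h0 : poly_eval a d 0 = 0)
  (hn : forall i, (1 <= i)%nat -> (0 < n i)%nat) :
  forall eps : R, eps > 0 ->
  exists alpha : list nat,
    finset_pos alpha /\ in_S d alpha /\
    dist_Z (poly_eval a d (INR (sum_over n alpha))) <= eps.
Proof.
  intros eps heps.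
  destruct (@BoundedGaps.bounded_gap_poly_recurrence a d n eps hd h0 heps) as [alpha [h1 h2 h3]].
  now exists alpha.
Qed.
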